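(* Let $f$ be a rational function with a zero or pole at $z_0\in\mathbb{C}$, such that $f$ has at least one finite zero or pole other than $z_0$ (so that $d_f(z_0)$ is defined). Then $f$ has no critical points in the punctured ball $\{z\in\mathbb{C}:0<|z-z_0|<R\}$ centered at $z_0$ with radius $$R=\dfrac{d_f(z_0)\cdot|\mathrm{mult}_f(z_0)|}{d_f(z_0)\cdot\rho_f(z_0)+|\mathrm{mult}_f(z_0)|}.$$
   Context: Rational functions are elements of $\mathbb{C}(z)$, not identically zero. For a rational function $f$, let $Z_f$ and $P_f$ denote the sets of distinct finite zeros and distinct finite poles of $f$, respectively. For $z\in Z_f\cup P_f$, $\mathrm{mult}_f(z)$ denotes the multiplicity of $z$ as a zero or pole of $f$, taken positive if $z$ is a zero and negative if $z$ is a pole. For $z\in\mathbb{C}$, $d_f(z)$ is the minimum distance from $z$ to any element of $(Z_f\cup P_f)\setminus\{z\}$ (defined when this set is nonempty), and $$\rho_f(z)=\sum_{w\in Z_f\cup P_f,\ w\neq z}\left|\dfrac{\mathrm{mult}_f(w)}{z-w}\right|.$$ A critical point of $f$ is a point of $\mathbb{C}$ that is a zero of $f'$. *)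

(* Defs.v *)
From HB Require Import structures.
From mathcomp Require Import all_boot all_order all_algebra.
From mathcomp Require Import all_classical all_reals.
From mathcomp Require Import complex ring.

Set Implicit Arguments.
Unset Strict Implicit.
Unset Printing Implicit Defensive.

Import Order.TTheory GRing.Theory Num.Theory ComplexField.Normc.

Local Open Scope classical_set_scope.
Local Open Scope ring_scope.
Local Open Scope complex_scope.

Section RationalFunctions.
Variable R : realType.
Local Notation C := R[i].
Implicit Types (f : {fraction {poly C}}) (p q : {poly C}) (z w : C).

Local Notation "p %:F" := (tofrac p).

Definition num f : {poly C} := \n_(repr f).
Definition den f : {poly C} := \d_(repr f).

(* [num f] and [den f] need not be coprime; see [mult_frac] for the
   independence of the representative. Not meaningful for [f = 0]. *)
Definition mult f z : int := (mup z (num f))%:Z - (mup z (den f))%:Z.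

(* Every point is a zero of the null function, in particular of the
   derivative of a constant. *)
Definition zeros f : set C := [set z | f = 0 \/ 0 < mult f z].

Definition poles f : set C := [set z | f <> 0 /\ mult f z < 0].

(* Quotient rule; see [ratderiv_frac]. *)
Definition ratderiv f : {fraction {poly C}} :=
  ((num f)^`() * den f - num f * (den f)^`())%:F / (den f ^+ 2)%:F.

Definition critical_points f : set C := zeros (ratderiv f).

Definition zeros_poles f : set C := zeros f `|` poles f.

(* The infimum is a minimum when the set is nonempty and [f != 0];
   see [dist_zp_min]. *)
Definition dist_zp f z : R :=
  inf [set normc (z - w) | w in zeros_poles f `\ z].

(* The index set is finite when [f != 0]; see [finite_zeros_poles]. *)
Definition rho f z : R :=
  \sum_(w \in zeros_poles f `\ z) normc ((mult f w)%:~R / (z - w)).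

Lemma den_neq0 f : den f != 0.
Proof. exact: denom_ratioP. Qed.

Lemma num_den f : f = (num f)%:F / (den f)%:F.
Proof.
rewrite /num /den -{1}[f]reprK -[repr f in LHS]FracField.Ratio_numden.
have d0 := denom_ratioP (repr f).
apply: (mulIf (x := (\d_(repr f))%:F)); first by rewrite tofrac_eq0.
rewrite divfK ?tofrac_eq0 // -[_ * _]/(FracField.mul _ _).
unlock tofrac; rewrite !piE.
apply/eqP; rewrite -/(_ == _ %[mod _]) FracField.equivf_def /FracField.mulf.
by rewrite !numden_Ratio ?mulr1 ?oner_neq0 // mulrC.
Qed.

Lemma frac_cross f p q : q != 0 -> f = p%:F / q%:F -> num f * q = p * den f.
Proof.
move=> q0 fE; have := num_den f; rewrite {1}fE => /eqP.
rewrite eqr_div ?tofrac_eq0 ?den_neq0 // -!tofracM tofrac_eq => /eqP.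
by [].
Qed.

Lemma mult_frac p q z : p != 0 -> q != 0 ->
  mult (p%:F / q%:F) z = (mup z p)%:Z - (mup z q)%:Z.
Proof.
move=> p0 q0; set f := _ / _.
have cE : num f * q = p * den f by exact: frac_cross.
have d0 := den_neq0 f.
have n0 : num f != 0.
  apply/eqP => n0; move: cE; rewrite n0 mul0r => /esym/eqP.
  by rewrite mulf_eq0 (negbTE p0) (negbTE d0).
have := congr1 (mup z) cE; rewrite !mupM // => /(congr1 Posz).
rewrite !PoszD /mult => H; apply/eqP.
by rewrite subr_eq addrAC eq_sym subr_eq eq_sym H.
Qed.

Lemma ratderiv_frac p q : q != 0 ->
  ratderiv (p%:F / q%:F) = (p^`() * q - p * q^`())%:F / (q ^+ 2)%:F.
Proof.
move=> q0; set f := _ / _.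
have cE : num f * q = p * den f by exact: frac_cross.
have d0 := den_neq0 f.
have := congr1 (@deriv _) cE; rewrite !derivM => dE.
apply/eqP; rewrite /ratderiv eqr_div ?tofrac_eq0 ?expf_neq0 //.
rewrite -!tofracM tofrac_eq; apply/eqP.
move: cE dE; set a := num f; set b := den f => cE dE.
have -> : (a^`() * b - a * b^`()) * q ^+ 2 =
  (a^`() * q + a * q^`()) * (b * q) - (a * q) * (b^`() * q + b * q^`()).
  by rewrite !mulrBl !mulrDl !mulrDr !opprD; ring.
by rewrite dE cE; ring.
Qed.

Lemma frac_eq0 p q : q != 0 -> (p%:F / q%:F == 0) = (p == 0).
Proof.
by move=> q0; rewrite mulf_eq0 invr_eq0 !tofrac_eq0 (negbTE q0) orbF.
Qed.

Lemma mup_gt0 p z : p != 0 -> (0 < mup z p)%N = root p z.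
Proof. by move=> p0; rewrite -XsubC_dvd // dvdp_XsubCl. Qed.

Lemma zeros_frac p q z : coprimep p q -> q != 0 ->
  zeros (p%:F / q%:F) z <-> root p z.
Proof.
move=> cpq q0; rewrite /zeros /=.
have [->|p0] := eqVneq p 0.
  by rewrite root0; split=> // _; left; apply/eqP; rewrite frac_eq0.
rewrite mult_frac // subr_gt0 ltz_nat; split=> [[/eqP|H]|rp].
- by rewrite frac_eq0 // (negbTE p0).
- by rewrite -mup_gt0 //; apply: leq_ltn_trans H.
- right; rewrite [mup z q]mupNroot ?mup_gt0 //.
  by apply/negP => rq; have := coprimep_root cpq rp; rewrite (eqP rq) eqxx.
Qed.

Lemma poles_frac p q z : coprimep p q -> p != 0 -> q != 0 ->
  poles (p%:F / q%:F) z <-> root q z.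
Proof.
move=> cpq p0 q0; rewrite /poles /= mult_frac // subr_lt0 ltz_nat.
split=> [[_ H]|rq]; first by rewrite -mup_gt0 //; apply: leq_ltn_trans H.
split; first by apply/eqP; rewrite frac_eq0.
rewrite [mup z p]mupNroot ?mup_gt0 //.
by apply/negP => rp; have := coprimep_root cpq rp; rewrite (eqP rq) eqxx.
Qed.

Lemma finite_zeros_poles f : f != 0 -> finite_set (zeros_poles f).
Proof.
move=> f0; have d0 := den_neq0 f.
have n0 : num f != 0 by rewrite -(frac_eq0 _ d0) -num_den.
have [r rE] := closed_field_poly_normal (num f * den f).
apply: (@sub_finite_set _ _ [set` r]); last exact: finite_seq.
have m0 : num f * den f != 0 by rewrite mulf_neq0.
move=> z H /=; rewrite -root_prod_XsubC.
suff: root (num f * den f) z by rewrite rE rootZ // lead_coef_eq0.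
rewrite rootM -!mup_gt0 //.
case: H => [[fE|]|[_]]; first by rewrite fE eqxx in f0.
- by rewrite subr_gt0 ltz_nat => H; rewrite (leq_ltn_trans _ H).
- by rewrite subr_lt0 ltz_nat => H; rewrite (leq_ltn_trans _ H) ?orbT.
Qed.

Lemma dist_zp_min f z : f != 0 -> zeros_poles f `\ z !=set0 ->
  (exists2 w, (zeros_poles f `\ z) w & dist_zp f z = normc (z - w)) /\
  (forall w, (zeros_poles f `\ z) w -> dist_zp f z <= normc (z - w)).
Proof.
move=> f0 [w0 Sw0]; set S := _ `\ _ in Sw0 *.
have fS : finite_set S by apply: finite_setD; exact: finite_zeros_poles.
have lbS : has_lbound [set normc (z - w) | w in S].
  exists 0 => _ [w _ <-]; case: (z - w) => a b; exact: sqrtr_ge0.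
split; last by move=> w Sw; apply: ge_inf => //; exists w.
have [s sE] := (finite_seqP S).1 fS.
have s0 : w0 \in s by move: Sw0; rewrite sE.
pose i0 : seq_sub s := SeqSub s0.
pose m := [arg min_(i < i0) normc (z - ssval i)]%O.
have mP (i : seq_sub s) : normc (z - ssval m) <= normc (z - ssval i).
  by rewrite /m; case: arg_minP => // j _; apply.
have Sm : S (ssval m) by rewrite sE /=; exact: ssvalP.
exists (ssval m) => //; apply/eqP; rewrite eq_le; apply/andP; split.
  by apply: ge_inf => //; exists (ssval m).
apply: lb_le_inf; first by exists (normc (z - w0)), w0.
move=> _ [w Sw <-]; have sw : w \in s by have : S w by []; rewrite sE.
exact: (mP (SeqSub sw)).
Qed.

End RationalFunctions.

(* Main.v *)
Require Import Defs.
From mathcomp Require Import all_boot all_order all_algebra.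
From mathcomp Require Import all_classical all_reals.
From mathcomp Require Import complex ring lra.

Set Implicit Arguments.
Unset Strict Implicit.
Unset Printing Implicit Defensive.

Import Order.TTheory GRing.Theory Num.Theory ComplexField.Normc.
Local Open Scope classical_set_scope.
Local Open Scope ring_scope.
Local Open Scope complex_scope.

(* With t = |z - z0| < d and m = |mult_f(z0)|, every other zero or pole w
   satisfies |z - w| >= |z0 - w| - t >= (1 - t / d) |z0 - w|, so in f'/f =
   sum_w mult_f(w) / (z - w) the terms with w != z0 add up to at most rho * d
   / (d - t) in modulus. This is less than m / t, the modulus of the term of
   z0, exactly when t < R; hence f'/f does not vanish at z. *)

(** Product rule, by induction on [r]. Entries of [r] may repeat, so multiple roots are covered. *)
Lemma horner_deriv_prod_XsubC (F : fieldType) (r : seq F) (z : F) :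
  (forall a, a \in r -> z != a) ->
  (\prod_(a <- r) ('X - a%:P))^`().[z] =
  (\prod_(a <- r) ('X - a%:P)).[z] * \sum_(a <- r) (z - a)^-1.
Proof.
elim: r => [|a r IH] zr; first by rewrite !big_nil derivC horner0 mulr0.
have za : z - a != 0 by rewrite subr_eq0 zr ?mem_head.
rewrite !big_cons derivM derivXsubC mul1r !hornerE.
rewrite IH => [|b br]; last by rewrite zr // inE br orbT.
by field.
Qed.

(** Groups equal entries of [r]. Elements of [s] outside [r] get count 0, so [s] may be larger than
    the support of [r]. *)
Lemma sum_count_mem (F : fieldType) (r s : seq F) (G : F -> F) :
  uniq s -> {subset r <= s} ->
  \sum_(a <- r) G a = \sum_(w <- s) (count_mem w r)%:R * G w.
Proof.
move=> us; elim: r => [|a r IH] rs.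
  by rewrite big_nil big1 // => w _; rewrite mul0r.
rewrite big_cons IH => [|b br]; last by rewrite rs // inE br orbT.
under [RHS]eq_bigr => w _ do rewrite /= natrD mulrDl.
rewrite big_split /=; congr (_ + _).
rewrite (bigD1_seq a) ?rs ?mem_head //= eqxx mul1r big1 ?addr0 // => w.
by rewrite eq_sym => /negbTE ->; rewrite mul0r.
Qed.

(** Over a closed field [p] splits, and grouping equal roots gives [p'/p]. Non-roots in [s] have
    multiplicity 0, which lets a numerator and a denominator share one list. *)
Lemma log_deriv_mup (F : closedFieldType) (p : {poly F}) (s : seq F) (z : F) :
  uniq s -> (forall a, root p a -> a \in s) -> ~~ root p z ->
  p^`().[z] = p.[z] * \sum_(w <- s) (mup w p)%:R * (z - w)^-1.
Proof.
move=> us ps pz.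
have p0 : p != 0 by apply: contraNneq pz => ->; rewrite root0.
have [r pE] := closed_field_poly_normal p.
have lc0 : lead_coef p != 0 by rewrite lead_coef_eq0.
have rootE a : root p a = (a \in r) by rewrite pE rootZ // root_prod_XsubC.
have mupE w : mup w p = count_mem w r.
  rewrite {1}pE -mul_polyC mupMr ?mu_prod_XsubC //.
  by rewrite rootC.
under eq_bigr => w _ do rewrite mupE.
rewrite -sum_count_mem // => [|a]; last by rewrite -rootE => /ps.
rewrite {1 2}pE derivZ !hornerZ horner_deriv_prod_XsubC ?mulrA // => a ar.
by apply: contraNneq pz => ->; rewrite rootE.
Qed.

(** Clearing the positive denominators [t] and [d - t] turns the conclusion into
    [d * rho * t < m * (d - t)], a rearrangement of the last hypothesis. *)
Lemma lt_div_radius (F : realFieldType) (d m rho t : F) :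
  0 < t -> t < d -> t * (d * rho + m) < d * m -> d / (d - t) * rho < m / t.
Proof.
move=> t0 td trE; rewrite ltr_pdivlMr // (_ : _ * t = d * rho * t / (d - t)); last by ring.
rewrite ltr_pdivrMr ?subr_gt0 //.
by nra.
Qed.

Section Normc.
Variable R : rcfType.
Implicit Types (x y z w : R[i]) (s : seq R[i]).

Lemma normc_ge0 x : 0 <= normc x.
Proof. by case: x => a b; exact: sqrtr_ge0. Qed.

Lemma normc_gt0 x : (0 < normc x) = (x != 0).
Proof.
rewrite lt_def normc_ge0 andbT; congr (~~ _).
by apply/eqP/eqP => [/eq0_normc //|->]; rewrite normc0.
Qed.

Lemma ler_normc_sum s (F : R[i] -> R[i]) :
  normc (\sum_(w <- s) F w) <= \sum_(w <- s) normc (F w).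
Proof.
elim: s => [|a s IH]; first by rewrite !big_nil normc0.
by rewrite !big_cons (le_trans (le_normcD _ _)) // lerD2l.
Qed.

Lemma normc_intr (k : int) : normc (k%:~R : R[i]) = `|k%:~R|.
Proof.
have normn n : normc (n%:R : R[i]) = n%:R.
  by rewrite [LHS](normcMn (1 : R[i])) normc1.
case: k => n; first by rewrite -!pmulrn normn normr_nat.
by rewrite NegzE !mulrNz -!pmulrn normcN normn normrN normr_nat.
Qed.

Lemma normc_div_shift (d : R) x z z0 w :
  normc (z - z0) < d -> d <= normc (z0 - w) ->
  normc (x / (z - w)) <= d / (d - normc (z - z0)) * normc (x / (z0 - w)).
Proof.
set t := normc (z - z0) => td dw.
have t0 : 0 <= t by exact: normc_ge0.
have tri : normc (z0 - w) <= t + normc (z - w).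
  rewrite /t -(normcN (z - z0)) opprB; apply: le_trans (le_normcD _ _).
  by rewrite subrKA.
have zw0 : 0 < normc (z - w) by lra.
have z0w0 : 0 < normc (z0 - w) by lra.
rewrite !normcM !normcV mulrCA ler_wpM2l ?normc_ge0 //.
rewrite -[leLHS]mul1r -[(normc (z0 - w))^-1]mul1r mulf_div ler_pdivrMr //.
rewrite mulrAC ler_pdivlMr ?mulr_gt0 ?subr_gt0 // mul1r mulr1.
(* The goal is now [(d - t) * normc (z0 - w) <= d * normc (z - w)]: multiply [tri] by [d] and use
   [t * d <= t * normc (z0 - w)]. *)
by nra.
Qed.

End Normc.

Section RationalFunctions.
Variable R : realType.
Local Notation C := R[i].
Implicit Types (f : {fraction {poly C}}) (p q : {poly C}) (z w : C).
Local Notation "p %:F" := (tofrac p).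

(** Zeros and poles are the roots of numerator and denominator only in lowest terms, whereas [num f]
    and [den f] may share factors. *)
Lemma coprime_frac f : f != 0 ->
  exists p q, [/\ coprimep p q, p != 0, q != 0 & f = p%:F / q%:F].
Proof.
move=> f0; have d0 := den_neq0 f.
have n0 : num f != 0 by rewrite -(frac_eq0 _ d0) -num_den.
set g := gcdp (num f) (den f).
have g0 : g != 0 by rewrite gcdp_eq0 (negbTE n0).
have nE : num f = num f %/ g * g by rewrite divpK // dvdp_gcdl.
have dE : den f = den f %/ g * g by rewrite divpK // dvdp_gcdr.
exists (num f %/ g), (den f %/ g); split.
- by rewrite coprimep_div_gcd // d0 orbT.
- by apply: contraNneq n0 => e; rewrite nE e mul0r.
- by apply: contraNneq d0 => e; rewrite dE e mul0r.
rewrite {1}[f]num_den {1}nE {1}dE !tofracM -mulf_div divff; last first.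
  by rewrite tofrac_eq0.
by rewrite mulr1.
Qed.

Lemma zeros_poles_frac p q z : coprimep p q -> p != 0 -> q != 0 ->
  zeros_poles (p%:F / q%:F) z <-> root p z || root q z.
Proof.
move=> cpq p0 q0; split=> [[/zeros_frac->|/poles_frac->]|/orP[]] //.
- by rewrite orbT.
- by move=> ?; left; apply/zeros_frac.
- by move=> ?; right; apply/poles_frac.
Qed.

Lemma critical_points_frac p q z : q != 0 ->
  critical_points (p%:F / q%:F) z -> p^`().[z] * q.[z] = p.[z] * q^`().[z].
Proof.
move=> q0; rewrite /critical_points ratderiv_frac //.
set N := _ - _ => H; suff : root N z.
  by rewrite rootE !hornerE subr_eq0 => /eqP.
(* [N = 0] is the case of a null derivative, where every point is critical and the identity is
   trivial. *)
have [->|N0] := eqVneq N 0; first by rewrite root0.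
have q20 : q ^+ 2 != 0 by rewrite expf_neq0.
case: H => [/eqP|]; first by rewrite frac_eq0 // (negbTE N0).
by rewrite mult_frac // subr_gt0 ltz_nat -mup_gt0 //; apply: leq_ltn_trans.
Qed.

(** Away from zeros and poles, [f' = 0] means [f'/f = p'/p - q'/q = 0]. The list [s] consists of the
    distinct roots of [p * q]. *)
Lemma critical_points_log_deriv f z : f != 0 ->
  critical_points f z -> ~ zeros_poles f z ->
  exists s : seq C, [/\ uniq s, zeros_poles f = [set` s] &
    \sum_(w <- s) (mult f w)%:~R / (z - w) = 0].
Proof.
move=> /coprime_frac[p [q [cpq p0 q0 ->]]] cz zz.
have zpE w := zeros_poles_frac w cpq p0 q0.
have := cz => /critical_points_frac => /(_ q0) dE.
have [rp rq] : ~~ root p z /\ ~~ root q z.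
  by apply/andP; rewrite -negb_or; apply/negP => /zpE.
have [s0 s0E] := closed_field_poly_normal (p * q).
have pq0 : p * q != 0 by rewrite mulf_neq0.
have s0P w : (w \in undup s0) = root p w || root q w.
  by rewrite mem_undup -rootM s0E rootZ ?lead_coef_eq0 // root_prod_XsubC.
exists (undup s0); split; first exact: undup_uniq.
  apply/seteqP; split=> w; first by move=> /zpE; rewrite -s0P.
  by move=> ws; apply/zpE; rewrite -s0P.
have ps a : root p a -> a \in undup s0 by rewrite s0P => ->.
have qs a : root q a -> a \in undup s0 by rewrite s0P orbC => ->.
move: dE; rewrite (log_deriv_mup _ ps rp) ?undup_uniq //.
rewrite (log_deriv_mup _ qs rq) ?undup_uniq // mulrAC mulrA.
(* The common factor [p.[z] * q.[z]] is nonzero; cancelling it leaves two sums over the same list,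
   subtracted termwise. *)
move=> /(mulfI (mulf_neq0 rp rq))/eqP; rewrite -subr_eq0 -sumrB => /eqP sum0.
rewrite -[RHS]sum0; apply: eq_bigr => w _.
by rewrite mult_frac // intrB mulrBl.
Qed.

Lemma rho_seq f z s : uniq s -> zeros_poles f = [set` s] ->
  rho f z = \sum_(w <- s | w != z) normc ((mult f w)%:~R / (z - w)).
Proof.
move=> us sE; rewrite -big_filter fsbig_seq ?filter_uniq //.
apply: eq_fsbigl; rewrite sE; apply/seteqP; split=> w /=.
  by move=> [ws /eqP wz]; rewrite mem_filter wz.
by rewrite mem_filter => /andP[/eqP wz ws].
Qed.

End RationalFunctions.

Theorem theorem1 (R : realType) (f : {fraction {poly R[i]}}) (z0 : R[i])
    (f_neq0 : f != 0)
    (z0_zp : zeros_poles f z0)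
    (other_zp : (zeros_poles f `\ z0) !=set0) :
  let d : R := dist_zp f z0 in
  let m : R := `|(mult f z0)%:~R| in
  let r : R := d * m / (d * rho f z0 + m) in
  forall z : R[i], 0 < normc (z - z0) < r -> ~ critical_points f z.
Proof.
move=> d m r z; set t := normc (z - z0) => /andP[t0 tr] cz.
have [[w0 [_ w0z0] dE] dmin] := dist_zp_min f_neq0 other_zp.
(* The infimum is attained at [w0], which differs from [z0]; hence it is positive. *)
have d0 : 0 < d.
  rewrite /d dE normc_gt0 subr_eq0; apply/eqP => e; exact: w0z0.
have m0 : 0 < m.
  rewrite normr_gt0 intr_eq0.
  by case: z0_zp => [[e|]|[_]]; [rewrite e eqxx in f_neq0|exact: lt0r_neq0|
    exact: ltr0_neq0].
have rho0 : 0 <= rho f z0.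
  by apply: sumr_ge0 => w _; exact: normc_ge0.
have den0 : 0 < d * rho f z0 + m by rewrite ltr_wpDl ?mulr_ge0 // ltW.
have trE : t * (d * rho f z0 + m) < d * m by rewrite -ltr_pdivlMr.
(* As [rho f z0] is nonnegative, [trE] gives [t * m < d * m]: the radius never exceeds [d]. *)
have td : t < d.
  rewrite -(ltr_pM2r m0); apply: le_lt_trans trE.
  by rewrite ler_pM2l // lerDr mulr_ge0 // ltW.
have zz : ~ zeros_poles f z.
  move=> zz; have /dmin : (zeros_poles f `\ z0) z.
    by split=> // /= e; rewrite /t e subrr normc0 ltxx in t0.
  by rewrite -normcN opprB leNgt td.
have [s [us sE]] := critical_points_log_deriv f_neq0 cz zz.
have sz0 : z0 \in s by have := z0_zp; rewrite sE.
(* The term of [z0] is the opposite of the sum of the others, so that sum has modulus [m / t]. *)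
rewrite (bigD1_seq z0 sz0 us) => /eqP; rewrite addr_eq0 => /eqP/(congr1 (@normc R)).
rewrite normcN normcM normcV normc_intr -/m -/t => mtE.
have : m / t <= d / (d - t) * rho f z0.
  rewrite mtE (rho_seq z0 us sE) mulr_sumr -big_filter.
  apply: le_trans (ler_normc_sum _ _) _.
  rewrite -[leRHS]big_filter 2!big_seq; apply: ler_sum => w.
  rewrite mem_filter => /andP[/eqP wz0 ws]; apply: (normc_div_shift _ td).
  by apply: dmin; split; [rewrite sE|exact: wz0].
by apply/negP; rewrite -ltNge; exact: lt_div_radius t0 td trE.
Qed.
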